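(* Let $\lambda$ be an odd positive integer and $k$ a positive integer, and suppose there is a $k$-MOFS$(2\lambda)$ with a full relation $(X_1,\dots,X_{k+2})$. If $k\equiv 1\pmod 8$ then $|X_1||X_2|\equiv 1\pmod 4$, and if $k\equiv 5\pmod 8$ then $|X_1||X_2|\equiv 3\pmod 4$.
   Context: Let $N(n)=\{1,\dots,n\}$ and let $n$ be even. A (binary) frequency square of order $n$ is an $n\times n$ array indexed by $N(n)\times N(n)$ with entries in $\{0,1\}$ such that every row and every column contains exactly $n/2$ zeros and $n/2$ ones. Two frequency squares $F,G$ of order $n$ are orthogonal if for each $(a,b)\in\{0,1\}^2$ the number of cells $(r,c)$ with $(F[r,c],G[r,c])=(a,b)$ equals $n^2/4$. A $k$-MOFS$(n)$ is an ordered set $F_1,\dots,F_k$ of pairwise orthogonal frequency squares of order $n$. Relations: form the $n^2\times(k+2)$ array $\mathcal O$ having a row $(i,j,F_1[i,j],\dots,F_k[i,j])$ for each $(i,j)\in N(n)^2$. Let $Y_1=Y_2=N(n)$ and $Y_c=\{0,1\}$ for $3\le c\le k+2$. A relation is a tuple $(X_1,\dots,X_{k+2})$ with $X_c\subseteq Y_c$ for all $c$ such that every row of $\mathcal O$ has an even number of positions $c$ for which the $c$-th entry of the row lies in $X_c$. A relation is trivial on column $c$ if $X_c=\emptyset$ or $X_c=Y_c$; it is full if it is non-trivial on every column $c\in\{1,\dots,k+2\}$ except possibly one of the columns $1,2$. *)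

(* Defs.v *)
From mathcomp Require Import all_boot all_algebra.
Set Implicit Arguments.
Unset Strict Implicit.
Unset Printing Implicit Defensive.

(* N(n) = {1, ..., n} is represented by 'I_n, and the symbols 0, 1 by
   false, true. *)

Definition freq_square (n : nat) (F : 'M[bool]_n) : Prop :=
  [/\ ~~ odd n,
      forall (i : 'I_n) (a : bool), #|[set j | F i j == a]| = n %/ 2
    & forall (j : 'I_n) (a : bool), #|[set i | F i j == a]| = n %/ 2].

Definition orthogonal_fs (n : nat) (F G : 'M[bool]_n) : Prop :=
  forall a b : bool,
    #|[set rc : 'I_n * 'I_n | (F rc.1 rc.2, G rc.1 rc.2) == (a, b)]|
    = n ^ 2 %/ 4.

Definition mofs (k n : nat) (F : 'I_k -> 'M[bool]_n) : Prop :=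
  (forall c, freq_square (F c)) /\
  (forall c d, c != d -> orthogonal_fs (F c) (F d)).

(* The tuple (X_1, ..., X_{k+2}) is given by its components X1, X2 on the two
   index columns and the family X on the k symbol columns (X c is X_{c+3}, as
   'I_k starts at 0).  The array has one row (i, j, F_1[i,j], ..., F_k[i,j])
   for each cell (i, j). *)
Definition is_relation (k n : nat) (F : 'I_k -> 'M[bool]_n)
    (X1 X2 : {set 'I_n}) (X : 'I_k -> {set bool}) : Prop :=
  forall i j : 'I_n,
    ~~ odd ((i \in X1) + (j \in X2) + \sum_(c < k) (F c i j \in X c)).

Definition trivial_on (Y : finType) (X : {set Y}) : Prop :=
  X = set0 \/ X = [set: Y].

Definition full (k n : nat)
    (X1 X2 : {set 'I_n}) (X : 'I_k -> {set bool}) : Prop :=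
  (forall c, ~ trivial_on (X c)) /\ (~ trivial_on X1 \/ ~ trivial_on X2).

(* Main.v *)
(** Encode membership of the symbols in the sets [X c] by signs, so that each
    square becomes a +-1 array with zero line sums, the arrays are pairwise
    orthogonal, and their product is [u i * v j] with [u], [v] the signs of
    [X1], [X2].  Let [s] be the sum of the k arrays.  Since k = 1 mod 4, the
    entries of [u i * v j * s i j] have the form [1 + 4 q i j].  Zero line sums
    give [sum (u v s) = 4 * sum_(X1 x X2) s], while orthogonality gives
    [sum s^2 = k n^2]; expanding [(1 + 4 q)^2] and using [q^2 = q mod 2] yields
    [k - 1 = 6 (|X1| |X2| - 1) mod 8]. *)
Require Import Defs.
From mathcomp Require Import all_boot all_algebra.
From mathcomp Require Import zify ring.
Import GRing.Theory.

Section Signs.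
Local Open Scope ring_scope.

Lemma sum_sign_card (T : finType) (f : T -> bool) :
  \sum_t (-1) ^+ f t =
  #|[set t | f t == false]|%:Z - #|[set t | f t == true]|%:Z.
Proof.
have card_sum b : #|[set t | f t == b]|%:Z = \sum_t (f t == b)%:R.
  rewrite cardsE -sum1_card -natz natr_sum big_mkcond /=.
  by apply: eq_bigr => t _; rewrite unfold_in; case: (f t); case: b.
rewrite !card_sum -sumrB; apply: eq_bigr => t _.
by case: (f t).
Qed.

(** Such an [A] is a singleton, so membership is the symbol itself or its negation. Each square thus
    gets sign-encoded up to a global sign. *)
Lemma nontrivial_set_bool (A : {set bool}) :
  ~ trivial_on A -> exists e, forall x, (x \in A) = x (+) e.
Proof.
move=> ntA; exists (false \in A) => x.
case At: (true \in A); case Af: (false \in A); last 1 first.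
- by case: ntA; left; apply/setP => -[]; rewrite ?At ?Af inE.
- by case: ntA; right; apply/setP => -[]; rewrite ?At ?Af inE.
- by case: x; rewrite ?At ?Af.
- by case: x; rewrite ?At ?Af.
Qed.

Lemma sum_sign (k : nat) (b : 'I_k -> bool) :
  \sum_c (-1) ^+ b c = k%:Z - 2 * (\sum_c b c)%N%:Z.
Proof.
have -> : k%:Z = \sum_(c < k) 1 by rewrite sumr_const card_ord natz.
rewrite -[X in 2 * X]natz natr_sum mulr_sumr -sumrB; apply: eq_bigr => c _.
by case: (b c).
Qed.

(** With [m] the number of true [b c], the sum of signs is [k - 2 m]. As [m] has the parity of
    [x + y], this is [1 - 2 (x + y)] modulo 4, which is congruent to the sign in front of it. *)
Lemma sum_sign_modz4 (k : nat) (b : 'I_k -> bool) (x y : bool) :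
    k = 1 %[mod 4] -> ~~ odd (x + y + \sum_c b c) ->
  exists q : int, (-1) ^+ x * (-1) ^+ y * \sum_c (-1) ^+ b c = 1 + 4 * q.
Proof.
rewrite sum_sign; move: (\sum_c b c)%N => m k1.
set r := (-1) ^+ x * _ * _ => even_sum.
exists ((r - 1) %/ 4)%Z; move: even_sum @r.
by case: x; case: y; rewrite /= ?expr0 ?expr1; lia.
Qed.

Lemma sum_cells_sqr (n : nat) (k : nat) (f : 'I_k -> 'I_n -> 'I_n -> int) :
    (forall c i j, f c i j ^+ 2 = 1) ->
    (forall c d, c != d -> \sum_i \sum_j f c i j * f d i j = 0) ->
  \sum_i \sum_j (\sum_c f c i j) ^+ 2 = (k * n ^ 2)%N%:Z.
Proof.
move=> f_sqr f_orth.
have -> : \sum_i \sum_j (\sum_c f c i j) ^+ 2 =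
          \sum_c \sum_d \sum_i \sum_j f c i j * f d i j.
  transitivity (\sum_i \sum_j \sum_c \sum_d f c i j * f d i j).
    apply: eq_bigr => i _; apply: eq_bigr => j _; rewrite expr2 mulr_suml.
    by apply: eq_bigr => c _; rewrite mulr_sumr.
  under eq_bigr => i _ do rewrite exchange_big.
  rewrite exchange_big; apply: eq_bigr => c _ /=.
  under eq_bigr => i _ do rewrite exchange_big.
  by rewrite exchange_big.
(* Only the diagonal terms [d = c] survive, each a sum of [n ^ 2] ones. *)
transitivity (\sum_(c < k) (n ^ 2)%N%:Z).
  apply: eq_bigr => c _; rewrite (bigD1 c) //= [X in _ + X]big1 ?addr0.
    under eq_bigr => i _ do under eq_bigr => j _ do rewrite -expr2 f_sqr.
    by rewrite !sumr_const !card_ord -mulrnA natz expnS expn1.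
  by move=> d dc; apply: f_orth; rewrite eq_sym.
by rewrite sumr_const card_ord -mulr_natl natz PoszM.
Qed.

(** A sign is 1 minus twice the indicator of its set. The constant 1 contributes a vanishing line
    sum, so each direction leaves a factor -2 and a restriction to the set. *)
Lemma sum_signed_cells (n : nat) (s : 'I_n -> 'I_n -> int)
    (A B : {set 'I_n}) :
    (forall i, \sum_j s i j = 0) -> (forall j, \sum_i s i j = 0) ->
  \sum_i \sum_j (-1) ^+ (i \in A) * (-1) ^+ (j \in B) * s i j =
  4 * \sum_(i in A) \sum_(j in B) s i j.
Proof.
move=> s_row s_col.
have sB i : \sum_j (-1) ^+ (j \in B) * s i j = - 2 * \sum_(j in B) s i j.
  transitivity (\sum_j ((-1) ^+ (j \in B) * s i j - s i j)).
    by rewrite sumrB s_row subr0.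
  rewrite [in RHS]big_mkcond mulr_sumr.
  by apply: eq_bigr => j _; case: (j \in B); rewrite ?expr1 ?expr0; ring.
under eq_bigr => i _ do under eq_bigr => j _ do rewrite -mulrA.
under eq_bigr => i _ do rewrite -mulr_sumr sB.
have col0 : \sum_i - 2 * \sum_(j in B) s i j = 0.
  rewrite -mulr_sumr exchange_big big1 ?mulr0 // => j _; exact: s_col.
rewrite -[LHS]subr0 -[X in _ - X]col0 -sumrB [in RHS]big_mkcond mulr_sumr.
by apply: eq_bigr => i _; case: (i \in A); rewrite ?expr1 ?expr0; ring.
Qed.

Lemma sqr_congr_mod2 (q : int) : exists w, q ^+ 2 = q + 2 * w.
Proof.
pose r := (q %/ 2)%Z; have [->|->] : q = 2 * r \/ q = 2 * r + 1 by lia.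
  by exists (2 * r ^+ 2 - r); ring.
by exists (2 * r ^+ 2 + r); ring.
Qed.

Lemma cells_congruence (k lambda : nat)
    (s : 'I_(2 * lambda) -> 'I_(2 * lambda) -> int)
    (A B : {set 'I_(2 * lambda)}) :
    (forall i, \sum_j s i j = 0) -> (forall j, \sum_i s i j = 0) ->
    \sum_i \sum_j s i j ^+ 2 = (k * (2 * lambda) ^ 2)%N%:Z ->
    (forall i j, exists q : int,
       (-1) ^+ (i \in A) * (-1) ^+ (j \in B) * s i j = 1 + 4 * q) ->
  exists z : int,
    (k%:Z - 1) * lambda%:Z ^+ 2 =
    6 * ((#|A| * #|B|)%N%:Z - lambda%:Z ^+ 2) + 8 * z.
Proof.
move=> s_row s_col s_sqr s_mod.
have [q qE] : exists q : 'I_(2 * lambda) -> 'I_(2 * lambda) -> int,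
    forall i j, (-1) ^+ (i \in A) * (-1) ^+ (j \in B) * s i j = 1 + 4 * q i j.
  exists (fun i j =>
    (((-1) ^+ (i \in A) * (-1) ^+ (j \in B) * s i j - 1) %/ 4)%Z) => i j.
  by case: (s_mod i j) => q ->; lia.
pose w i j := ((q i j ^+ 2 - q i j) %/ 2)%Z.
have wE i j : q i j ^+ 2 = q i j + 2 * w i j.
  by rewrite /w; case: (sqr_congr_mod2 (q i j)) => v ->; lia.
set Q : int := \sum_i \sum_j q i j.
set W : int := \sum_i \sum_j w i j.
set QA : int := \sum_(i in A) \sum_(j in B) q i j.
have sumA : \sum_(i in A) \sum_(j in B) s i j = (#|A| * #|B|)%N%:Z + 4 * QA.
  (* On [A] x [B] both signs are -1 and cancel. *)
  transitivity (\sum_(i in A) \sum_(j in B) (1 + 4 * q i j)).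
    apply: eq_bigr => i iA; apply: eq_bigr => j jB.
    by rewrite -qE iA jB; ring.
  under eq_bigr => i _ do rewrite big_split -mulr_sumr /= sumr_const.
  by rewrite big_split -mulr_sumr /= sumr_const -mulrnA mulnC [X in X + _]natz.
have sum1 : \sum_(i < 2 * lambda) \sum_(j < 2 * lambda) (1 : int) =
            4 * lambda%:Z ^+ 2.
  by rewrite !sumr_const !card_ord -mulrnA [LHS]natz !PoszM; ring.
have sumQ : 4 * lambda%:Z ^+ 2 + 4 * Q =
            4 * ((#|A| * #|B|)%N%:Z + 4 * QA).
  rewrite -sumA -sum_signed_cells // -sum1 /Q mulr_sumr -big_split.
  apply: eq_bigr => i _; rewrite mulr_sumr -big_split.
  by apply: eq_bigr => j _; rewrite qE.
(* Signs disappear on squaring, and [1 + 8 q + 16 q^2] becomes [1 + 24 q + 32 w]. *)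
have sumS : 4 * k%:Z * lambda%:Z ^+ 2 = 4 * lambda%:Z ^+ 2 + 24 * Q + 32 * W.
  transitivity (\sum_i \sum_j s i j ^+ 2).
    by rewrite s_sqr !PoszM; ring.
  rewrite -sum1 /Q /W !mulr_sumr -!big_split; apply: eq_bigr => i _.
  rewrite !mulr_sumr -!big_split; apply: eq_bigr => j _ /=.
  have -> : s i j ^+ 2 = (1 + 4 * q i j) ^+ 2.
    by rewrite -qE !exprMn !sqrr_sign !mul1r.
  have -> : (1 + 4 * q i j) ^+ 2 = 1 + 8 * q i j + 16 * q i j ^+ 2 by ring.
  by rewrite wE; ring.
(* Divide [sumS] by 4 and insert [Q = |A| |B| - lambda^2 + 4 QA] from [sumQ]; then
   [6 * 4 QA = 8 * 3 QA]. *)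
by exists (3 * QA + W); lia.
Qed.

End Signs.

Theorem theorem2p5 (lambda k : nat)
    (lambda_gt0 : 0 < lambda) (lambda_odd : odd lambda) (k_gt0 : 0 < k)
    (F : 'I_k -> 'M[bool]_(2 * lambda)) (F_mofs : mofs F)
    (X1 X2 : {set 'I_(2 * lambda)}) (X : 'I_k -> {set bool})
    (X_rel : is_relation F X1 X2 X) (X_full : full X1 X2 X) :
  (k = 1 %[mod 8] -> #|X1| * #|X2| = 1 %[mod 4]) /\
  (k = 5 %[mod 8] -> #|X1| * #|X2| = 3 %[mod 4]).
Proof.
(* Both residues of [k] modulo 8 are 1 modulo 4. Since an odd square is 1 modulo 8, [main] reduces
   to [k - 1 = 6 (ab - 1)] modulo 8; halving and inverting 3 modulo 4 determines [ab]. *)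
suff main : k = 1 %[mod 4] -> exists z : int,
    ((k%:Z - 1) * lambda%:Z ^+ 2 =
     6 * ((#|X1| * #|X2|)%N%:Z - lambda%:Z ^+ 2) + 8 * z)%R.
  have [t lambda_sqr] : exists t, lambda ^ 2 = 1 + 8 * t.
    pose r := lambda %/ 4.
    have [->|->] : lambda = 4 * r + 1 \/ lambda = 4 * r + 3 by lia.
      by exists (2 * r ^ 2 + r); ring.
    by exists (2 * r ^ 2 + 3 * r + 1); ring.
  have lambdaZ : (lambda%:Z ^+ 2 = 1 + 8 * t%:Z)%R.
    by rewrite -[LHS]/(lambda%:Z * lambda%:Z)%R; lia.
  move: main; rewrite lambdaZ; set ab := #|X1| * #|X2| => main.
  by split=> k_mod; have [|z] := main; try lia;
    rewrite mulrDr mulr1 mulrCA => zE; lia.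
move=> k_mod; case: F_mofs => F_fs F_orth; case: X_full => X_nt _.
pose f c i j : int := ((-1) ^+ (F c i j \in X c))%R.
have fE c : exists e : bool, forall i j,
    f c i j = ((-1) ^+ e * (-1) ^+ F c i j)%R.
  have [e eE] := nontrivial_set_bool (X c) (X_nt c).
  by exists e => i j; rewrite /f eE signr_addb mulrC.
apply: (cells_congruence k lambda (fun i j => \sum_c f c i j)%R).
- move=> i; rewrite exchange_big big1 // => c _.
  have [e eE] := fE c; under eq_bigr => j _ do rewrite eE.
  case: (F_fs c) => _ row _.
  by rewrite -mulr_sumr sum_sign_card !row subrr mulr0.
- move=> j; rewrite exchange_big big1 // => c _.
  have [e eE] := fE c; under eq_bigr => i _ do rewrite eE.
  case: (F_fs c) => _ _ col.
  by rewrite -mulr_sumr sum_sign_card !col subrr mulr0.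
- apply: sum_cells_sqr => [c i j|c d cd]; first exact: sqrr_sign.
  have [e eE] := fE c; have [e' eE'] := fE d.
  rewrite pair_bigA /=.
  (* The global signs factor out, and the product of the two entry signs is the sign of their
     xor. *)
  under eq_bigr => p _ do rewrite eE eE' mulrACA -(signr_addb _ (F c _ _)).
  rewrite -mulr_sumr sum_sign_card.
  (* The xor equals [b] exactly at the symbol pairs [(false, b)] and [(true, ~~ b)], whose cell sets
     are disjoint. *)
  have card_xor b : #|[set p | F c p.1 p.2 (+) F d p.1 p.2 == b]| =
      (2 * lambda) ^ 2 %/ 4 + (2 * lambda) ^ 2 %/ 4.
    rewrite -{1}(F_orth c d cd false b) -(F_orth c d cd true (~~ b)).
    rewrite -cardsUI [X in _ + #|pred_of_set X|](_ : _ = set0) ?cards0 ?addn0.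
      congr #|pred_of_set _|; apply/setP => p; rewrite !inE !xpair_eqE.
      by case: (F c _ _); case: (F d _ _); case: b.
    apply/setP => p; rewrite !inE !xpair_eqE.
    by case: (F c _ _); case: (F d _ _); case: b.
  by rewrite !card_xor subrr mulr0.
- by move=> i j; apply: sum_sign_modz4 => //; apply: X_rel.
Qed.
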